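(* The variety of pseudo equality algebras is congruence permutable and congruence distributive.
   Context: A pseudo equality algebra is an algebra $(X;\sim,\backsim,\wedge,1)$ of type $(2,2,2,0)$ such that for all $a,b,c\in X$ (with $x\le y$ iff $x\wedge y=x$): (F1) $(X;\wedge,1)$ is a meet-semilattice with top element $1$; (F2) $a\sim a=1=a\backsim a$; (F3) $a\sim 1=a=1\backsim a$; (F4) $a\leq b\leq c$ implies $a\sim c\leq b\sim c$, $a\sim c\leq a\sim b$, $c\backsim a\leq c\backsim b$ and $c\backsim a\leq b\backsim a$; (F5) $a\sim b\leq (a\wedge c)\sim (b\wedge c)$ and $a\backsim b\leq (a\wedge c)\backsim (b\wedge c)$; (F6) $a\sim b\leq (c\sim a)\backsim (c\sim b)$ and $a\backsim b\leq (a\backsim c)\sim (b\backsim c)$; (F7) $a\sim b\leq (a\sim c)\sim (b\sim c)$ and $a\backsim b\leq (c\backsim a)\backsim (c\backsim b)$. These algebras form a variety, since (F4) can be rewritten by inequalities between terms. A variety is congruence permutable if $\theta\circ\psi=\psi\circ\theta$ for all congruences $\theta,\psi$ of each of its algebras, and congruence distributive if the congruence lattice of each of its algebras is distributive. *)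

(* Defs.v *)
From HB Require Import structures.
From mathcomp Require Import all_boot all_order.
From mathcomp Require Import boolp classical_sets.

Set Implicit Arguments.
Unset Strict Implicit.
Unset Printing Implicit Defensive.

Import Order.TTheory.
Local Open Scope classical_set_scope.

(* Algebras of type (2,2,2,0), before any axiom is imposed. *)
Record algebra : Type := Algebra {
  carrier :> Type;
  sim : carrier -> carrier -> carrier;
  bsim : carrier -> carrier -> carrier;
  wedge : carrier -> carrier -> carrier;
  one : carrier }.

Arguments one {a}.

Definition below (X : algebra) (x y : X) : Prop := wedge x y = x.

Record pseudo_equality_algebra (X : algebra) : Prop := PseudoEqualityAlgebra {
  pea_wedgeA : associative (@wedge X);
  pea_wedgeC : commutative (@wedge X);
  pea_wedgexx : idempotent_op (@wedge X);
  pea_le1 : forall a : X, below a one;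
  pea_simxx : forall a : X, sim a a = one;
  pea_bsimxx : forall a : X, bsim a a = one;
  pea_simx1 : forall a : X, sim a one = a;
  pea_bsim1x : forall a : X, bsim one a = a;
  pea_sim_le_l : forall a b c : X,
    below a b -> below b c -> below (sim a c) (sim b c);
  pea_sim_le_r : forall a b c : X,
    below a b -> below b c -> below (sim a c) (sim a b);
  pea_bsim_le_r : forall a b c : X,
    below a b -> below b c -> below (bsim c a) (bsim c b);
  pea_bsim_le_l : forall a b c : X,
    below a b -> below b c -> below (bsim c a) (bsim b a);
  pea_sim_wedge : forall a b c : X,
    below (sim a b) (sim (wedge a c) (wedge b c));
  pea_bsim_wedge : forall a b c : X,
    below (bsim a b) (bsim (wedge a c) (wedge b c));
  pea_sim_bsim : forall a b c : X,
    below (sim a b) (bsim (sim c a) (sim c b));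
  pea_bsim_sim : forall a b c : X,
    below (bsim a b) (sim (bsim a c) (bsim b c));
  pea_sim_sim : forall a b c : X,
    below (sim a b) (sim (sim a c) (sim b c));
  pea_bsim_bsim : forall a b c : X,
    below (bsim a b) (bsim (bsim c a) (bsim c b)) }.

Definition compatible (X : algebra) (op : X -> X -> X) (r : set (X * X)) :=
  forall x y u v : X, r (x, y) -> r (u, v) -> r (op x u, op y v).

Record is_congruence (X : algebra) (r : set (X * X)) : Prop := IsCongruence {
  cong_refl : forall x : X, r (x, x);
  cong_sym : forall x y : X, r (x, y) -> r (y, x);
  cong_trans : forall x y z : X, r (x, y) -> r (y, z) -> r (x, z);
  cong_sim : compatible (@sim X) r;
  cong_bsim : compatible (@bsim X) r;
  cong_wedge : compatible (@wedge X) r }.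

Record congruence (X : algebra) : Type := Congruence {
  cong_rel :> set (X * X);
  cong_relP : `[< is_congruence cong_rel >] }.

Fact cong_display : Order.disp_t. Proof. exact: (Order.Disp tt tt). Qed.

Section CongruenceLattice.
Variable X : algebra.

HB.instance Definition _ := [isSub for @cong_rel X].
HB.instance Definition _ := [Choice of congruence X by <:].
(* The order inherited from [set (X * X)] is inclusion of relations. *)
HB.instance Definition _ := [SubChoice_isSubPOrder of congruence X by <: with cong_display].

Lemma congruenceP (r : congruence X) : is_congruence r.
Proof. exact/asboolP/cong_relP. Qed.

Lemma is_congruenceI (r s : congruence X) : is_congruence (r `&` s).
Proof.
have cr := congruenceP r; have cs := congruenceP s.
split=> [x|x y [? ?]|x y z [? ?] [? ?]|x y u v [? ?] [? ?]
  |x y u v [? ?] [? ?]|x y u v [? ?] [? ?]]; split.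
all: first [exact: cong_refl | exact: cong_sym | exact: (cong_trans _ (y := y))
  | exact: cong_sim | exact: cong_bsim | exact: cong_wedge].
Qed.

Lemma is_congruence_smallest (G : set (X * X)) :
  is_congruence (smallest (@is_congruence X) G).
Proof.
split=> [x|x y h|x y z h k|x y u v h k|x y u v h k|x y u v h k] M [cM GM].
- exact: cong_refl.
- by apply: (cong_sym cM); exact: h.
- by apply: (cong_trans cM (y := y)); [exact: h|exact: k].
- by apply: (cong_sim cM); [exact: h|exact: k].
- by apply: (cong_bsim cM); [exact: h|exact: k].
- by apply: (cong_wedge cM); [exact: h|exact: k].
Qed.

Definition cong_meet (r s : congruence X) : congruence X :=
  Congruence (introT (asboolP _) (is_congruenceI r s)).

Definition cong_join (r s : congruence X) : congruence X :=
  Congruence (introT (asboolP _) (is_congruence_smallest (r `|` s))).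

Lemma cong_leE (r s : congruence X) : (r <= s)%O <-> cong_rel r `<=` cong_rel s.
Proof.
by split=> [/(@subsetPset _ (cong_rel r) (cong_rel s))|/subsetPset].
Qed.

Lemma cong_meetP (r s t : congruence X) :
  (r <= cong_meet s t)%O = (r <= s)%O && (r <= t)%O.
Proof.
apply/idP/andP => [/cong_leE h|[/cong_leE h /cong_leE k]].
  by split; apply/cong_leE => x /h [].
by apply/cong_leE => x rx; split; [exact: h|exact: k].
Qed.

Lemma cong_joinP (r s t : congruence X) :
  (cong_join r s <= t)%O = (r <= t)%O && (s <= t)%O.
Proof.
apply/idP/andP => [/cong_leE h|[/cong_leE h /cong_leE k]].
  by split; apply/cong_leE => x rx; apply: h; apply: sub_gen_smallest;
    [left|right].
apply/cong_leE; apply: smallest_sub; first exact: congruenceP.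
by move=> x [/h|/k].
Qed.

HB.instance Definition _ :=
  Order.POrder_MeetJoin_isLattice.Build _ (congruence X) cong_meetP cong_joinP.

End CongruenceLattice.

(* The library's [B \; A] applies [A] first; the order is immaterial here, since
   the equation is required for all pairs. *)
Definition congruence_permutable (V : set algebra) : Prop :=
  forall X : algebra, V X -> forall r s : congruence X,
    (cong_rel r \; cong_rel s)%relation = (cong_rel s \; cong_rel r)%relation.

Definition congruence_distributive (V : set algebra) : Prop :=
  forall X : algebra, V X ->
    left_distributive (@Order.meet _ (congruence X)) (@Order.join _ (congruence X)).

(* Main.v *)
From mathcomp Require Import all_boot all_order.
From mathcomp Require Import classical_sets.
Require Import Defs.

Set Implicit Arguments.
Unset Strict Implicit.
Unset Printing Implicit Defensive.

Import Order.TTheory.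
Local Open Scope classical_set_scope.

(** Both halves are Mal'cev conditions: it is enough to find, among the term
operations, a Mal'cev operation [p x x z = z], [p x z z = x] and a majority
operation.  Write [x ~ y] for [sim x y], [x # y] for [bsim x y].

The key inequality is [x <= (y ~ x) # y] ([below_bsim_sim]), the case [b = 1]
of the axiom [a ~ b <= (c ~ a) # (c ~ b)].  Since moreover [x ~ x = 1] and
[1 # z = z], the meet of [(y ~ x) # z] and [(y ~ z) # x] collapses to [z] when
[x = y] and to [x] when [y = z]: this is the Mal'cev operation.

For a majority operation it suffices, in a meet-semilattice, to have an
idempotent term [q] such that [q x y] is an upper bound of [x] and [y]: then
[q x y /\ q y z /\ q z x] is a majority operation, because when two of the
arguments are equal to [a], one of the three factors is [q a a = a] and the
other two are above [a].  Here [q x y = u # (u /\ y)] with [u = y ~ x].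

A Mal'cev operation makes congruences permute, whence the join of two
congruences is their composition; if moreover the ends of [x r y s z] are
related by a third congruence [t], a majority operation turns [y] into an
element [m x y z] that is also [t]-related to both ends ([join_meet_sub]). *)

(** * Congruences and the operations they preserve *)

Section MalcevConditions.
Variable X : algebra.
Implicit Types r s t : congruence X.

(** Every term operation has this property, and it is all that the arguments
with Mal'cev conditions use of a term. *)
Definition congruence_preserving3 (f : X -> X -> X -> X) :=
  forall r x x' y y' z z', cong_rel r (x, x') -> cong_rel r (y, y') ->
    cong_rel r (z, z') -> cong_rel r (f x y z, f x' y' z').

Definition malcev_operation (p : X -> X -> X -> X) :=
  (forall x z, p x x z = z) /\ (forall x z, p x z z = x).

Definition majority_operation (m : X -> X -> X -> X) :=
  [/\ forall x y, m x x y = x, forall x y, m x y x = x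
    & forall x y, m y x x = x].

Lemma congruence_refl r x : cong_rel r (x, x).
Proof. exact: cong_refl (congruenceP r) x. Qed.

Lemma congruence_sym r x y : cong_rel r (x, y) -> cong_rel r (y, x).
Proof. exact: cong_sym (congruenceP r) x y. Qed.

Lemma congruence_trans r x y z :
  cong_rel r (x, y) -> cong_rel r (y, z) -> cong_rel r (x, z).
Proof. exact: cong_trans (congruenceP r) x y z. Qed.

(** If [x r y s z], then [x = p x y y] is [s]-related to [p x y z], which is
[r]-related to [p y y z = z]. *)
Lemma malcev_composite_sub p r s :
    congruence_preserving3 p -> malcev_operation p ->
  (cong_rel s \; cong_rel r `<=` cong_rel r \; cong_rel s)%relation.
Proof.
move=> pc [pl pr] [x z] [y /= rxy syz]; exists (p x y z).
  by rewrite -{1}(pr x y); apply: pc => //; exact: congruence_refl.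
by rewrite -[X in cong_rel r (_, X)](pl y z); apply: pc => //;
  exact: congruence_refl.
Qed.

Lemma malcev_composite_congruence p r s :
    congruence_preserving3 p -> malcev_operation p ->
  is_congruence (cong_rel s \; cong_rel r)%relation.
Proof.
move=> pc pm; have cr := congruenceP r; have cs := congruenceP s.
split=> [x|x z [y /= rxy syz]|x z x' [y /= rxy syz] [y' /= rzy' syx']
  |x z x' z' [y /= ? ?] [y' /= ? ?]|x z x' z' [y /= ? ?] [y' /= ? ?]
  |x z x' z' [y /= ? ?] [y' /= ? ?]].
- by exists x; exact: congruence_refl.
- by apply: (@malcev_composite_sub p s r pc pm (z, x)); exists y;
    exact: congruence_sym.
- (* the inner pair [y s z r y'] of [x r y s z r y' s x'] is swapped *)
  have [|w /= ryw swy'] := @malcev_composite_sub p s r pc pm (y, y').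
    by exists z.
  by exists w; [exact: congruence_trans ryw|exact: congruence_trans syx'].
- by exists (sim y y'); exact: cong_sim.
- by exists (bsim y y'); exact: cong_bsim.
- by exists (wedge y y'); exact: cong_wedge.
Qed.

Lemma malcev_join_sub p r s :
    congruence_preserving3 p -> malcev_operation p ->
  cong_rel (r `|` s)%O `<=` (cong_rel s \; cong_rel r)%relation.
Proof.
move=> pc pm; apply: smallest_sub; first exact: malcev_composite_congruence pm.
by move=> [x y] [rxy|sxy]; [exists y|exists x] => //; exact: congruence_refl.
Qed.

(** For [x r y s z] with [x t z], the element [m x y z] is [r]-related to
[m x x z = x] and [s]-related to [m x z z = z], while replacing [z] by [x], or
[x] by [z], shows that it is [t]-related to [m x y x = x] and [m z y z = z]. *)
Lemma join_meet_sub p m r s t :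
    congruence_preserving3 p -> malcev_operation p ->
    congruence_preserving3 m -> majority_operation m ->
  ((r `|` s) `&` t <= (r `&` t) `|` (s `&` t))%O.
Proof.
move=> pc pm mc [m1 m2 m3]; apply/cong_leE => -[x z] [rs txz].
have [y /= rxy syz] := malcev_join_sub pc pm rs.
have tzx := congruence_sym txz.
apply: (@congruence_trans ((r `&` t) `|` (s `&` t))%O x (m x y z) z).
  apply: sub_gen_smallest; left; split.
    by rewrite -{1}(m1 x z); apply: mc => //; exact: congruence_refl.
  by rewrite -{1}(m2 x y); apply: mc => //; exact: congruence_refl.
apply: sub_gen_smallest; right; split.
  by rewrite -[X in cong_rel s (_, X)](m3 z x); apply: mc => //;
    exact: congruence_refl.
by rewrite -[X in cong_rel t (_, X)](m2 z y); apply: mc => //;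
  exact: congruence_refl.
Qed.

End MalcevConditions.

(** * The term operations of a pseudo equality algebra *)

Section PseudoEqualityAlgebra.
Variable X : algebra.
Hypothesis XP : pseudo_equality_algebra X.
Implicit Types x y z : X.

Lemma below_trans x y z : below x y -> below y z -> below x z.
Proof. by rewrite /below => xy yz; rewrite -xy -(pea_wedgeA XP) yz. Qed.

Lemma wedge_absorbr x y : below x y -> wedge y x = x.
Proof. by rewrite (pea_wedgeC XP). Qed.

Lemma wedge1x x : wedge one x = x.
Proof. exact/wedge_absorbr/(pea_le1 XP). Qed.

Lemma below_bsim_sim x y : below x (bsim (sim y x) y).
Proof. by have := pea_sim_bsim XP x one y; rewrite !(pea_simx1 XP). Qed.

Definition malcev_term x y z := wedge (bsim (sim y x) z) (bsim (sim y z) x).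

Lemma malcev_termP : malcev_operation malcev_term.
Proof.
split=> x z; rewrite /malcev_term (pea_simxx XP) (pea_bsim1x XP).
  exact: below_bsim_sim.
exact/wedge_absorbr/below_bsim_sim.
Qed.

Lemma malcev_term_preserving : congruence_preserving3 malcev_term.
Proof.
move=> r x x' y y' z z' rx ry rz; have cr := congruenceP r.
by apply: (cong_wedge cr); apply: (cong_bsim cr) => //; exact: (cong_sim cr).
Qed.

(** The simpler [(y ~ x) # y] lies above [x]; taking the meet with [y ~ x] in
the second argument makes the value lie above [y] as well. *)
Definition upper_term x y := bsim (sim y x) (wedge (sim y x) y).

Lemma upper_termxx x : upper_term x x = x.
Proof. by rewrite /upper_term (pea_simxx XP) (pea_bsim1x XP) wedge1x. Qed.

(** With [u = y ~ x], meeting both arguments with [u] gives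
[x <= u # y <= (u /\ u) # (y /\ u)]. *)
Lemma below_upper_terml x y : below x (upper_term x y).
Proof.
apply: below_trans (below_bsim_sim x y) _.
have := pea_bsim_wedge XP (sim y x) y (sim y x).
by rewrite (pea_wedgexx XP) (pea_wedgeC XP y).
Qed.

(** Here meeting with [u = y ~ x] gives
[y = 1 # y <= (1 /\ u) # (y /\ u)]. *)
Lemma below_upper_termr x y : below y (upper_term x y).
Proof.
have := pea_bsim_wedge XP one y (sim y x).
by rewrite (pea_bsim1x XP) wedge1x (pea_wedgeC XP y).
Qed.

Definition majority_term x y z :=
  wedge (upper_term x y) (wedge (upper_term y z) (upper_term z x)).

Lemma majority_termP : majority_operation majority_term.
Proof.
split=> x y; rewrite /majority_term upper_termxx.
- rewrite (pea_wedgeA XP) below_upper_terml; exact: below_upper_termr.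
- rewrite (wedge_absorbr (below_upper_termr y x)).
  exact/wedge_absorbr/below_upper_terml.
- rewrite below_upper_terml; exact/wedge_absorbr/below_upper_termr.
Qed.

Lemma majority_term_preserving : congruence_preserving3 majority_term.
Proof.
move=> r x x' y y' z z' rx ry rz; have cr := congruenceP r.
have up a a' b b' : cong_rel r (a, a') -> cong_rel r (b, b') ->
    cong_rel r (upper_term a b, upper_term a' b').
  move=> ra rb; have rs := cong_sim cr rb ra.
  by apply: (cong_bsim cr) => //; exact: (cong_wedge cr).
by do 2?[apply: (cong_wedge cr)]; exact: up.
Qed.

End PseudoEqualityAlgebra.

Theorem theorem4p16 :
  congruence_permutable pseudo_equality_algebra /\
  congruence_distributive pseudo_equality_algebra.
Proof.
split=> X XP.
  have comm (r s : congruence X) :=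
    @malcev_composite_sub X _ r s (@malcev_term_preserving X) (malcev_termP XP).
  move=> r s; apply/seteqP; split=> u; exact: comm.
move=> r s t; apply/eqP; rewrite eq_le; apply/andP; split.
  exact: join_meet_sub (@malcev_term_preserving X) (malcev_termP XP)
    (@majority_term_preserving X) (majority_termP XP).
(* the reverse inclusion holds in every lattice *)
by rewrite leUx !leI2 // ?leUl ?leUr.
Qed.
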